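(* Let $e\geq 2$ and let $\Gamma_e=VO^+(2e,2)$, realised on the set of all $2\times e$ matrices over $\mathbb{F}_2$. Let $W_1$ be the set of matrices whose second row is zero, and let $v$ be the matrix with entry $1$ in position $(2,e)$ and $0$ elsewhere. Define $V_1=\{x\in W_1: x_{1e}=1\}$, $V_2=\{x\in v+W_1: x_{1e}=0\}$, and let $C$ be the set of matrices $x$ with $x_{1e}=0$, $x_{2,e-1}=1$, $x_{2j}=0$ for all $j<e-1$ (the entries $x_{1j}$ for $j<e$ and $x_{2e}$ being arbitrary). Let $\Gamma_{e,2}$ be the graph obtained from $\Gamma_e$ by first switching the edges between $W_1$ and $v+W_1$, and then switching the edges between $V_1\cup V_2$ and $C$. Then $\Gamma_{e,2}$ is a strictly Neumaier graph that is edge-regular with parameters $$\bigl(2^{2e},\ (2^{e-1}+1)(2^e-1),\ 2(2^{e-2}+1)(2^{e-1}-1)\bigr)$$ and contains a $2^{e-1}$-regular $2^e$-clique. Further, with $\mu=2^{e-1}(2^{e-1}+1)$, the numbers of common neighbours of pairs of distinct non-adjacent vertices of $\Gamma_{e,2}$ take exactly the values $\mu-2^{e-1}$, $\mu$ and $\mu+2^{e-1}$.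
   Context: All graphs are finite, simple and undirected. For a $2\times e$ matrix $x=(x_{ij})$ over $\mathbb{F}_2$ define $Q(x)=\sum_{j=1}^{e} x_{1j}x_{2j}$ (the scalar product of its two rows). The affine polar graph $VO^+(2e,2)$ has vertex set the $2\times e$ matrices over $\mathbb{F}_2$, two distinct matrices $x,y$ adjacent iff $Q(x-y)=0$; it is strongly regular with parameters $(2^{2e},(2^{e-1}+1)(2^e-1),2(2^{e-2}+1)(2^{e-1}-1),2^{e-1}(2^{e-1}+1))$. For a set $X$ of matrices and a matrix $v$, $v+X=\{v+x:x\in X\}$. For disjoint vertex sets $S,T$ of a graph, switching the edges between $S$ and $T$ means: for each $x\in S$ and each $t\in T$, delete the edge $xt$ if present and insert it if absent. A graph on $v$ vertices is edge-regular with parameters $(v,k,\lambda)$ if it has at least one edge, is $k$-regular, and every two adjacent vertices have exactly $\lambda$ common neighbours; it is strongly regular if additionally it is non-complete and any two distinct non-adjacent vertices have a constant number of common neighbours. A clique $S$ in a regular graph is $m$-regular if every vertex outside $S$ is adjacent to exactly $m>0$ vertices of $S$. A strictly Neumaier graph is a non-complete edge-regular graph containing a regular clique which is not strongly regular. *)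

(* Defs.v *)
From mathcomp Require Import all_boot all_order all_algebra.

Set Implicit Arguments.
Unset Strict Implicit.
Unset Printing Implicit Defensive.

Import GRing.Theory.
Local Open Scope ring_scope.

Section Graphs.
Variable T : finType.
Implicit Types (G : rel T) (S U : {set T}).

Definition simple_graph G : Prop := symmetric G /\ irreflexive G.

Definition nbrs G x : {set T} := [set y | G x y].

Definition common_nbrs G x y : {set T} := nbrs G x :&: nbrs G y.

Definition complete_graph G : Prop := forall x y, x != y -> G x y.

Definition edge_regular G (v k l : nat) : Prop :=
  [/\ simple_graph G,
      #|T| = v,
      exists x y, G x y,
      forall x, #|nbrs G x| = k
    & forall x y, G x y -> #|common_nbrs G x y| = l].

Definition strongly_regular G : Prop :=
  [/\ exists v k l, edge_regular G v k l,
      ~ complete_graph G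
    & exists mu : nat, forall x y, x != y -> ~~ G x y ->
        #|common_nbrs G x y| = mu].

Definition clique G S : Prop :=
  forall x y, x \in S -> y \in S -> x != y -> G x y.

Definition regular_clique G (m : nat) S : Prop :=
  [/\ clique G S, (0 < m)%N
    & forall x, x \notin S -> #|nbrs G x :&: S| = m].

Definition strictly_Neumaier G : Prop :=
  [/\ exists v k l, edge_regular G v k l,
      ~ complete_graph G,
      exists m S, regular_clique G m S
    & ~ strongly_regular G].

(* Meant for disjoint S and U. *)
Definition switch S U G : rel T := fun x y =>
  G x y (+) ((x \in S) && (y \in U) || (x \in U) && (y \in S)).

End Graphs.

(* Rows and columns are numbered from 0: the entry written x_{ij} on paper is
   x (i-1) (j-1).  Column e is the j : 'I_e with j.+1 = e, and column e-1 the
   one with j.+2 = e. *)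
Section AffinePolar.
Variable e : nat.
Local Notation mat := 'M['F_2]_(2, e).

Definition Q (x : mat) : 'F_2 := \sum_(j < e) x 0 j * x 1 j.

Definition VOplus : rel mat := fun x y => (x != y) && (Q (x - y) == 0).

Definition W1 : {set mat} := [set x : mat | row 1 x == 0].

Definition vmat : mat := \matrix_(i, j) ((i == 1) && (j.+1 == e))%:R.

Definition translate (u : mat) (X : {set mat}) : {set mat} :=
  [set u + x | x in X].

Definition V1 : {set mat} :=
  [set x in W1 | [forall j : 'I_e, (j.+1 == e) ==> (x 0 j == 1)]].

Definition V2 : {set mat} :=
  [set x in translate vmat W1 |
    [forall j : 'I_e, (j.+1 == e) ==> (x 0 j == 0)]].

Definition Cset : {set mat} :=
  [set x : mat | [forall j : 'I_e,
    [&& (j.+1 == e) ==> (x 0 j == 0),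
        (j.+2 == e) ==> (x 1 j == 1)
      & (j.+2 < e)%N ==> (x 1 j == 0)]]].

Definition Gamma2 : rel mat :=
  switch (V1 :|: V2) Cset (switch W1 (translate vmat W1) VOplus).

End AffinePolar.

(* Main.v *)
Require Import Defs.
From mathcomp Require Import all_boot all_order all_algebra.
From mathcomp Require Import ring zify.

(* Record a graph by a symmetric form q with values in F_2: distinct x and y are
   adjacent when q x y = 0.  If the signs (-1)^(q x z) have the same sum over z
   for every x, the number of common neighbours of x and y is determined by
   q x y and by the inner product of the rows x and y of the sign matrix.

   Write a matrix as (a, b, c), where a and b are its rows without their last
   entries and c is its last column.  Both switchings preserve the shape
     q (a, b, c) (a', b', c') = (a - a') . (b - b') + f b b' c c',
   and only change the 4 x 4 sign matrices f b b'.  Summing over a, two rows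
   with b1 <> b2 are orthogonal, and for b1 = b2 = b the inner product is a
   signed sum over b' of inner products of rows of f b b'.  After the first
   switching all these matrices still have orthogonal rows.  The second one
   spoils this exactly for {b, b'} = {0, p}, where p is the value of b on C: so
   each row meets at most one bad block, and there non-orthogonal rows come from
   non-adjacent vertices. *)

Set Implicit Arguments.
Unset Strict Implicit.
Unset Printing Implicit Defensive.

Import GRing.Theory.
Local Open Scope ring_scope.

Lemma F2_cases (a : 'F_2) : a = 0 \/ a = 1.
Proof. by case: a => [[|[|m]] //= h]; [left|right]; apply: val_inj. Qed.

Definition chi (a : 'F_2) : int := (-1) ^+ (a != 0).

Lemma chi_cases a : chi a = 1 \/ chi a = -1.
Proof. by case: (F2_cases a) => ->; [left|right]. Qed.

Lemma chiD : {morph chi : a b / a + b >-> a * b}.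
Proof. by move=> a b; case: (F2_cases a) (F2_cases b) => -> [] ->. Qed.

Lemma chiB : {morph chi : a b / a - b >-> a * b}.
Proof. by move=> a b; case: (F2_cases a) (F2_cases b) => -> [] ->. Qed.

Lemma chi_sqr a : chi a * chi a = 1.
Proof. by case: (chi_cases a) => ->. Qed.

Lemma eq0_chi a : (a == 0)%:R *+ 2 = 1 + chi a.
Proof. by case: (F2_cases a) => ->. Qed.

Lemma card_eq0_chi (T : finType) (A : {set T}) (h : T -> 'F_2) :
  #|[set z in A | h z == 0]|%:Z *+ 2 = #|A|%:Z + \sum_(z in A) chi (h z).
Proof.
rewrite -sum1dep_card -sum1_card -!natz !natr_sum -sumrMnl big_mkcondr.
rewrite -big_split; apply: eq_bigr => z _ /=.
by rewrite -eq0_chi; case: (_ == _).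
Qed.

Section DotProduct.
Variables (R : comPzRingType) (m : nat).
Implicit Types a b : 'rV[R]_m.

Definition dot a b : R := \sum_j a 0 j * b 0 j.

Lemma dotC a b : dot a b = dot b a.
Proof. by apply: eq_bigr => j _; rewrite mulrC. Qed.

Lemma dotBl a1 a2 b : dot (a1 - a2) b = dot a1 b - dot a2 b.
Proof. by rewrite /dot -sumrB; apply: eq_bigr => j _; rewrite !mxE mulrBl. Qed.

Lemma dotBr a b1 b2 : dot a (b1 - b2) = dot a b1 - dot a b2.
Proof. by rewrite dotC dotBl !(dotC a). Qed.

Lemma dotZl k a b : dot (k *: a) b = k * dot a b.
Proof. by rewrite /dot mulr_sumr; apply: eq_bigr => j _; rewrite mxE mulrA. Qed.

Lemma dot0r a : dot a 0 = 0.
Proof. by rewrite /dot big1 // => j _; rewrite mxE mulr0. Qed.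

Lemma dot_delta j b : dot (delta_mx 0 j) b = b 0 j.
Proof.
rewrite /dot (bigD1 j) //= big1 ?addr0 ?mxE ?eqxx ?mul1r // => k kj.
by rewrite mxE (negbTE kj) andbF mul0r.
Qed.

End DotProduct.

Lemma dot_surjective (F : fieldType) m (u : 'rV[F]_m) s :
  u != 0 -> exists a, dot a u = s.
Proof.
case/rV0Pn => j uj; exists ((s / u 0 j) *: delta_mx 0 j).
by rewrite dotZl dot_delta divfK.
Qed.

Lemma sum_chi_dot m (u : 'rV['F_2]_m) :
  \sum_a chi (dot a u) = (2 ^ m)%N%:Z *+ (u == 0).
Proof.
case: (altP eqP) => [->|/rV0Pn[j uj]].
  under eq_bigr do rewrite dot0r.
  by rewrite sumr_const card_mx card_Fp // mul1n natz.
set S := LHS; suff: S = - S by rewrite mulr0n; lia.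
rewrite {1}/S (reindex_inj (subIr (delta_mx 0 j))) -sumrN /=.
apply: eq_bigr => a _; rewrite dotBl chiB dot_delta.
by case: (F2_cases (u 0 j)) uj => -> //= _; rewrite mulrN1.
Qed.

Section FormGraphs.
Variable T : finType.
Implicit Types (q : T -> T -> 'F_2) (G : rel T).

Definition form_graph q : rel T := fun x y => (x != y) && (q x y == 0).

Definition sign_dot q x y : int := \sum_z chi (q x z) * chi (q y z).

Lemma switch_form_graph (S U : {set T}) G q :
  [disjoint S & U] -> G =2 form_graph q ->
  switch S U G =2 form_graph (fun x y => q x y
    + ((x \in S) && (y \in U) || (x \in U) && (y \in S))%:R).
Proof.
move=> SU Gq x y; rewrite /switch Gq /form_graph.
case: (eqVneq x y) => [<-|_] /=.
  rewrite [(x \in U) && _]andbC orbb; apply/negP => /andP[xS].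
  by rewrite (disjointFr SU xS).
by case: (_ || _); case: (F2_cases (q x y)) => ->.
Qed.

Section Counting.
Variables (q : T -> T -> 'F_2) (G : rel T) (r : int).
Hypothesis q_sym : forall x y, q x y = q y x.
Hypothesis q_diag : forall x, q x x = 0.
Hypothesis Gq : G =2 form_graph q.
Hypothesis q_sum : forall x, \sum_z chi (q x z) = r.

Lemma form_graph_simple : simple_graph G.
Proof.
by split=> [x y|x]; rewrite !Gq /form_graph ?eqxx // eq_sym q_sym.
Qed.

Lemma card_nbrs_form x : (#|nbrs G x|%:Z + 1) *+ 2 = #|T|%:Z + r.
Proof.
have -> : #|nbrs G x|%:Z + 1 = #|[set z in [set: T] | q x z == 0]|%:Z.
  rewrite (cardsD1 x [set z in _ | _]) !inE q_diag eqxx addrC PoszD.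
  by congr (_ + _%:Z); apply: eq_card => z; rewrite !inE Gq /form_graph eq_sym.
rewrite card_eq0_chi cardsT -(q_sum x); congr (_ + _).
by apply: eq_bigl => z; rewrite inE.
Qed.

Lemma card_common_nbrs_form x y : x != y ->
  (#|common_nbrs G x y|%:Z + (G x y)%:Z *+ 2) *+ 4
  = #|T|%:Z + r *+ 2 + sign_dot q x y.
Proof.
move=> xy; set A := [set z | (q x z == 0) && (q y z == 0)].
have -> : #|common_nbrs G x y|%:Z + (G x y)%:Z *+ 2 = #|A|%:Z.
  rewrite (cardsD1 x A) (cardsD1 y (A :\ x)) !inE !q_diag (q_sym y x).
  rewrite (eq_sym y) Gq /form_graph xy eqxx !andbT /=.
  have -> : #|(A :\ x) :\ y| = #|common_nbrs G x y|.
    apply: eq_card => z; rewrite !inE !Gq /form_graph (eq_sym x) (eq_sym y).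
    by case: (z == x); case: (z == y) => //=; rewrite andbF.
  by rewrite !PoszD; ring.
rewrite -sum1dep_card -[Posz _]natz natr_sum -sumrMnl big_mkcond /=.
rewrite -[r *+ 2]/(r + r) -{1}(q_sum x) -(q_sum y) -sum1_card.
rewrite -[Posz (bigop _ _ _)]natz natr_sum -!big_split.
apply: eq_bigr => z _ /=.
by case: (F2_cases (q x z)) (F2_cases (q y z)) => -> [] ->.
Qed.

End Counting.
End FormGraphs.

Lemma sign_dot_bij (S T : finType) (h : S -> T) (q : T -> T -> 'F_2) x y :
  bijective h ->
  sign_dot (fun u w => q (h u) (h w)) x y = sign_dot q (h x) (h y).
Proof.
by move=> h_bij; rewrite /sign_dot [RHS](reindex h) //; apply: onW_bij.
Qed.

Lemma card_nbrs_setI_form (T : finType) (G : rel T) (q : T -> T -> 'F_2)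
    (S : {set T}) x :
  G =2 form_graph q -> x \notin S ->
  #|nbrs G x :&: S|%:Z *+ 2 = #|S|%:Z + \sum_(z in S) chi (q x z).
Proof.
move=> Gq xS; rewrite -card_eq0_chi; congr (_%:Z *+ 2); apply: eq_card => z.
rewrite !inE Gq /form_graph andbC; case: (boolP (z \in S)) => //= zS.
by rewrite (_ : x != z) //; apply: contraNneq xS => ->.
Qed.

Lemma strictly_Neumaier_criterion (T : finType) (G : rel T) v k l m S
    x y x' y' :
  edge_regular G v k l -> regular_clique G m S ->
  x != y -> ~~ G x y -> x' != y' -> ~~ G x' y' ->
  #|common_nbrs G x y| != #|common_nbrs G x' y'| -> strictly_Neumaier G.
Proof.
move=> er rc xy Gxy xy' Gxy' neq; split; [by exists v, k, l| |by exists m, S|].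
  by move=> /(_ _ _ xy); apply/negP.
by case=> _ _ [mu mu_const]; move: neq; rewrite !mu_const // eqxx.
Qed.

Lemma sum_triple (V : nmodType) (A B C : finType) (P : B -> pred C)
    (F : A * B * C -> V) :
  \sum_(z | P z.1.2 z.2) F z = \sum_b \sum_(c | P b c) \sum_a F (a, b, c).
Proof.
pose Fcond a b c := if P b c then F (a, b, c) else 0.
transitivity (\sum_z Fcond z.1.1 z.1.2 z.2).
  by rewrite big_mkcond; apply: eq_bigr => [[[a b] c] _].
rewrite -(pair_bigA _ (fun ab => Fcond ab.1 ab.2)) /=.
rewrite -(pair_bigA _ (fun a b => \sum_c Fcond a b c)) /=.
rewrite exchange_big; apply: eq_bigr => b _.
rewrite exchange_big [RHS]big_mkcond /=.
by apply: eq_bigr => c _; rewrite /Fcond; case: (P b c); rewrite ?big1_eq.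
Qed.

Section BlockForms.
Variables (m : nat) (K : finType).
Local Notation vec := 'rV['F_2]_m.
Variable f : vec -> vec -> K -> K -> 'F_2.
Implicit Types (a b : vec) (c : K).

Definition block_form (x z : vec * vec * K) : 'F_2 :=
  let: (a, b, c) := x in let: (a', b', c') := z in
  dot (a - a') (b - b') + f b b' c c'.

Lemma sum_chi_block_form (P : vec -> pred K) a b c :
  \sum_(z | P z.1.2 z.2) chi (block_form (a, b, c) z)
  = (2 ^ m)%N%:Z * \sum_(c' | P b c') chi (f b b c c').
Proof.
have sum_a b' c' : \sum_a' chi (block_form (a, b, c) (a', b', c'))
    = (2 ^ m)%N%:Z *+ (b == b') * chi (f b b' c c').
  under eq_bigr do rewrite /= chiD.
  rewrite -mulr_suml (reindex_inj (subrI a)) /=; congr (_ * _).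
  by under eq_bigr do rewrite subKr; rewrite sum_chi_dot subr_eq0.
rewrite sum_triple (bigD1 b) //= [X in _ + X]big1 ?addr0 => [|b' b'b].
  by rewrite mulr_sumr; apply: eq_bigr => c' _; rewrite sum_a eqxx.
by apply: big1 => c' _; rewrite sum_a eq_sym (negbTE b'b) mul0r.
Qed.

Lemma sign_dot_block_form a1 b1 c1 a2 b2 c2 :
  sign_dot block_form (a1, b1, c1) (a2, b2, c2)
  = (2 ^ m)%N%:Z *+ (b1 == b2)
    * \sum_b chi (dot (a1 - a2) (b2 - b))
        * (\sum_c chi (f b1 b c1 c) * chi (f b2 b c2 c)).
Proof.
have sum_a b c :
    \sum_a chi (dot (a1 - a) (b1 - b)) * chi (dot (a2 - a) (b2 - b))
    = (2 ^ m)%N%:Z *+ (b1 == b2) * chi (dot (a1 - a2) (b2 - b)).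
  rewrite -subr_eq0 -sum_chi_dot mulr_suml (reindex_inj (subrI a1)).
  apply: eq_bigr => a _; rewrite subKr (_ : a2 - (a1 - a) = a - (a1 - a2)).
    have -> : b1 - b2 = (b1 - b) - (b2 - b) by rewrite opprB addrA subrK.
    by rewrite dotBl chiB mulrA -chiB -dotBr.
  by rewrite !opprB addrCA.
rewrite /sign_dot (sum_triple (fun _ _ => true)) mulr_sumr.
apply: eq_bigr => b _; rewrite mulrA -sum_a // mulr_sumr.
apply: eq_bigr => c _; rewrite mulr_suml; apply: eq_bigr => a _ /=.
by rewrite !chiD mulrACA.
Qed.

Lemma sign_dot_same_cell a1 a2 b c :
  a1 != a2 -> sign_dot block_form (a1, b, c) (a2, b, c) = 0.
Proof.
move=> a12; rewrite sign_dot_block_form.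
under eq_bigr do under eq_bigr do rewrite chi_sqr.
rewrite -mulr_suml (reindex_inj (subrI b)) /=.
under eq_bigr do rewrite subKr dotC.
by rewrite sum_chi_dot subr_eq0 (negbTE a12) mul0r mulr0.
Qed.

Lemma sign_dot_single_block b b0 a1 c1 a2 c2 :
  (forall b', b' != b0 -> sign_dot (f b b') c1 c2 = 0) ->
  sign_dot block_form (a1, b, c1) (a2, b, c2)
  = (2 ^ m)%N%:Z * chi (dot (a1 - a2) (b - b0)) * sign_dot (f b b0) c1 c2.
Proof.
move=> orth; rewrite sign_dot_block_form eqxx -mulrA (bigD1 b0) //=.
rewrite [X in _ + X]big1 ?addr0 // => b' /orth.
by rewrite /sign_dot => ->; rewrite mulr0.
Qed.

Lemma block_form_sym :
  (forall b b' c c', f b b' c c' = f b' b c' c) ->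
  forall x z, block_form x z = block_form z x.
Proof.
move=> f_sym [[a b] c] [[a' b'] c'] /=; rewrite f_sym; congr (_ + _).
by apply: eq_bigr => j _; rewrite !mxE -[RHS]mulrNN !opprB.
Qed.

Lemma block_form_same_bottom a b c a' c' :
  block_form (a, b, c) (a', b, c') = f b b c c'.
Proof. by rewrite /= subrr dot0r add0r. Qed.

End BlockForms.

Definition cell : finType := ('F_2 * 'F_2)%type.

Definition polar_cell (c d : cell) : 'F_2 := (c.1 - d.1) * (c.2 - d.2).

Definition first_switch_cell (c d : cell) : 'F_2 :=
  (c.1 - d.1 + 1) * (c.2 - d.2).

Definition second_switch_cell (c d : cell) : 'F_2 :=
  polar_cell c d + ((c.1 != c.2) && (d.1 == 0))%:R.

Lemma cell_cases (c : cell) :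
  [\/ c = (0, 0), c = (0, 1), c = (1, 0) | c = (1, 1)].
Proof.
by case: c => s t; case: (F2_cases s) (F2_cases t) => -> [] ->; constructor.
Qed.

Lemma sum_cell (F : cell -> int) :
  \sum_c F c = F (0, 0) + F (0, 1) + F (1, 0) + F (1, 1).
Proof.
transitivity (\sum_(s : 'F_2) \sum_(t : 'F_2) F (s, t)).
  by rewrite pair_bigA; apply: eq_bigr => [[s t] _].
rewrite !big_ord_recl !big_ord0 !addr0 addrA.
by have -> : lift ord0 ord0 = 1 :> 'F_2 by apply: val_inj.
Qed.

Lemma sign_dot_polar_cell c d : c != d -> sign_dot polar_cell c d = 0.
Proof.
by rewrite /sign_dot sum_cell;
  case: (cell_cases c) => ->; case: (cell_cases d) => ->.
Qed.

Lemma sign_dot_first_switch_cell c d :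
  c != d -> sign_dot first_switch_cell c d = 0.
Proof.
by rewrite /sign_dot sum_cell;
  case: (cell_cases c) => ->; case: (cell_cases d) => ->.
Qed.

Lemma sum_polar_cell c : \sum_d chi (polar_cell c d) = 2.
Proof. by rewrite sum_cell; case: (cell_cases c) => ->. Qed.

Lemma sum_first_switch_cell c : \sum_d chi (first_switch_cell c d) = 2.
Proof. by rewrite sum_cell; case: (cell_cases c) => ->. Qed.

Lemma sign_dot_second_switch_cell c d : c != d ->
  sign_dot second_switch_cell c d
  = (4 * chi (c.1 + 1)) *+ (first_switch_cell c d == 1).
Proof.
by rewrite /sign_dot sum_cell;
  case: (cell_cases c) => ->; case: (cell_cases d) => ->.
Qed.

Lemma sign_dot_second_switch_cell_tr c d : c != d ->
  sign_dot (fun c d => second_switch_cell d c) c d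
  = (4 * chi (c.1 + c.2 + 1)) *+ (polar_cell c d == 1).
Proof.
by rewrite /sign_dot sum_cell;
  case: (cell_cases c) => ->; case: (cell_cases d) => ->.
Qed.

(* [p] is the second row, without its last entry, of the matrices in [Cset]. *)
Section GammaForm.
Variables (m : nat) (p : 'rV['F_2]_m).
Local Notation vec := 'rV['F_2]_m.
Implicit Types (a b : vec) (c d : cell).

Definition coord_W1 b c := (b == 0) && (c.2 == 0).
Definition coord_vW1 b c := (b == 0) && (c.2 == 1).
Definition coord_V b c := (b == 0) && (c.1 != c.2).
Definition coord_C b c := (b == p) && (c.1 == 0).

Definition gamma_block b b' : cell -> cell -> 'F_2 :=
  if (b == 0) && (b' == 0) then first_switch_cell
  else if (b == 0) && (b' == p) then second_switch_cell
  else if (b == p) && (b' == 0) then fun c d => second_switch_cell d c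
  else polar_cell.

Definition gamma_form : vec * vec * cell -> vec * vec * cell -> 'F_2 :=
  block_form gamma_block.

Lemma gamma_blockE b b' c d : p != 0 ->
  gamma_block b b' c d = polar_cell c d
    + (coord_W1 b c && coord_vW1 b' d || coord_vW1 b c && coord_W1 b' d)%:R
    + (coord_V b c && coord_C b' d || coord_C b c && coord_V b' d)%:R.
Proof.
move=> p0; rewrite /gamma_block /coord_W1 /coord_vW1 /coord_V /coord_C.
have [->|_] := eqVneq b 0; have [->|_] := eqVneq b' 0; rewrite ?[0 == p]eq_sym.
all: rewrite ?(negbTE p0) /= ?andbF ?orbF ?addr0 //; case: (_ == p) => //=.
all: by case: (cell_cases c) => ->; case: (cell_cases d) => ->; apply: val_inj.
Qed.

Lemma gamma_block_diag b :
  gamma_block b b = if b == 0 then first_switch_cell else polar_cell.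
Proof. by rewrite /gamma_block; case: (b == 0); rewrite ?andbF. Qed.

Lemma gamma_block_0p : p != 0 -> gamma_block 0 p = second_switch_cell.
Proof. by move=> p0; rewrite /gamma_block eqxx (negbTE p0) eqxx. Qed.

Lemma gamma_form_diag x : gamma_form x x = 0.
Proof.
case: x => [[a b] c].
rewrite /gamma_form block_form_same_bottom gamma_block_diag.
by case: ifP => _; rewrite /first_switch_cell /polar_cell !subrr mulr0.
Qed.

Lemma gamma_form_sym x z : gamma_form x z = gamma_form z x.
Proof.
have polar_sym c d : polar_cell c d = polar_cell d c.
  by rewrite /polar_cell -mulrNN !opprB.
have first_switch_sym c d : first_switch_cell c d = first_switch_cell d c.
  by case: (cell_cases c) => ->; case: (cell_cases d) => ->; apply: val_inj.
apply: block_form_sym => b b' c d; rewrite /gamma_block.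
by case: (b == 0) (b' == 0) (b == p) (b' == p) => [] [] [] [] /=.
Qed.

Lemma sum_chi_gamma_form x : \sum_z chi (gamma_form x z) = (2 ^ m.+1)%N.
Proof.
case: x => [[a b] c]; rewrite (sum_chi_block_form _ (fun _ _ => true)).
rewrite gamma_block_diag (fun_if (fun f => \sum_d chi (f c d))).
by rewrite sum_first_switch_cell sum_polar_cell if_same expnSr PoszM.
Qed.

(* For b = 0 or p, the other one is p - b; for every other b the block at p - b
   is polar, and excluding it costs nothing. *)
Lemma sign_dot_gamma_block_unpaired b b' c d :
  c != d -> b' != p - b -> sign_dot (gamma_block b b') c d = 0.
Proof.
move=> cd; rewrite /gamma_block.
case: ifP => _; first by rewrite sign_dot_first_switch_cell.
case: ifP => [/andP[/eqP-> /eqP->]|_]; first by rewrite subr0 eqxx.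
case: ifP => [/andP[/eqP-> /eqP->]|_ _]; first by rewrite subrr eqxx.
exact: sign_dot_polar_cell.
Qed.

Lemma sign_dot_gamma_block_paired b c d : c != d ->
  sign_dot (gamma_block b (p - b)) c d = 0 \/
  gamma_block b b c d = 1 /\
  exists s, sign_dot (gamma_block b (p - b)) c d = 4 * chi s.
Proof.
move=> cd; rewrite gamma_block_diag /gamma_block.
case: ifP => _; first by left; apply: sign_dot_first_switch_cell.
have [->|_] := eqVneq b 0; rewrite ?subr0 ?eqxx /=.
  rewrite sign_dot_second_switch_cell //; case: eqP => [->|_]; last by left.
  by right; split=> //; exists (c.1 + 1).
case: ifP => _; last by left; apply: sign_dot_polar_cell.
rewrite sign_dot_second_switch_cell_tr //; case: eqP => [->|_]; last by left.
by right; split=> //; exists (c.1 + c.2 + 1).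
Qed.

Lemma sign_dot_gamma_form_same_bottom b a1 c1 a2 c2 : c1 != c2 ->
  sign_dot gamma_form (a1, b, c1) (a2, b, c2)
  = (2 ^ m)%N%:Z * chi (dot (a1 - a2) (b - (p - b)))
    * sign_dot (gamma_block b (p - b)) c1 c2.
Proof.
move=> c12; apply: sign_dot_single_block => b'.
exact: sign_dot_gamma_block_unpaired.
Qed.

Lemma sign_dot_gamma_form_cases x y : x != y ->
  sign_dot gamma_form x y = 0 \/
  gamma_form x y = 1 /\
  exists s, sign_dot gamma_form x y = (2 ^ m.+2)%N%:Z * chi s.
Proof.
case: x y => [[a1 b1] c1] [[a2 b2] c2] xy.
have [b12|b12] := eqVneq b1 b2; last first.
  by left; rewrite sign_dot_block_form (negbTE b12) mul0r.
rewrite -{}b12 in xy *; have [c12|c12] := eqVneq c1 c2.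
  left; rewrite -c12 in xy *; apply: sign_dot_same_cell.
  by apply: contraNneq xy => ->.
rewrite sign_dot_gamma_form_same_bottom // /gamma_form block_form_same_bottom.
have [->|[-> [s ->]]] := sign_dot_gamma_block_paired b1 c12.
  by left; rewrite mulr0.
right; split=> //; exists (dot (a1 - a2) (b1 - (p - b1)) + s).
by rewrite chiD !expnSr !PoszM; ring.
Qed.

Lemma exists_sign_dot_gamma_form_chi s : p != 0 -> exists u w,
  gamma_form u w = 1 /\ sign_dot gamma_form u w = (2 ^ m.+2)%N%:Z * chi s.
Proof.
move=> p0; have [a ap] := dot_surjective s p0.
exists (a, 0, (1, 0)), (0, 0, (1, 1)); split.
  rewrite /gamma_form block_form_same_bottom gamma_block_diag eqxx.
  exact: val_inj.
rewrite sign_dot_gamma_form_same_bottom // !subr0 dotBr dot0r ap chiB mul1r.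
rewrite gamma_block_0p //.
rewrite sign_dot_second_switch_cell // (_ : _ *+ _ = 4) // !expnSr !PoszM.
by ring.
Qed.

Lemma exists_sign_dot_gamma_form0 : p != 0 -> exists u w,
  gamma_form u w = 1 /\ sign_dot gamma_form u w = 0.
Proof.
move=> p0; have [a ap] := dot_surjective 1 p0.
exists (a, 0, (0, 0)), (0, p, (0, 0)); split; last first.
  by rewrite sign_dot_block_form eq_sym (negbTE p0) mul0r.
rewrite /gamma_form /block_form subr0 dotBr dot0r ap gamma_block_0p //.
exact: val_inj.
Qed.

Lemma gamma_form_W1 x z :
  coord_W1 x.1.2 x.2 -> coord_W1 z.1.2 z.2 -> gamma_form x z = 0.
Proof.
case: x z => [[a b] c] [[a' b'] c'].
move=> /andP[/= /eqP-> /eqP c0] /andP[/= /eqP-> /eqP c'0].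
rewrite subrr dot0r add0r gamma_block_diag eqxx.
by rewrite /first_switch_cell c0 c'0 subrr mulr0.
Qed.

Lemma sum_chi_gamma_form_W1 x :
  \sum_(z | coord_W1 z.1.2 z.2) chi (gamma_form x z)
  = (2 ^ m.+1)%N%:Z *+ coord_W1 x.1.2 x.2.
Proof.
case: x => [[a b] c]; rewrite sum_chi_block_form /coord_W1 /=.
have [->|_] := eqVneq b 0; last by rewrite big_pred0 // mulr0.
rewrite gamma_block_diag eqxx big_mkcond sum_cell expnSr PoszM.
by case: (cell_cases c) => -> /=; rewrite ?mulr1n ?mulr0n ?mulr0.
Qed.

End GammaForm.

Lemma forall_last n (P : pred 'I_n.+1) :
  [forall j : 'I_n.+1, (j.+1 == n.+1) ==> P j] = P ord_max.
Proof.
apply/forallP/idP => [/(_ ord_max)|Pmax j]; first by rewrite eqxx.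
by apply/implyP => /eqP[jn]; rewrite (_ : j = ord_max) //; apply: val_inj.
Qed.

Lemma in_translate e (u x : 'M['F_2]_(2, e)) (X : {set 'M['F_2]_(2, e)}) :
  (x \in translate u X) = (x - u \in X).
Proof.
apply/imsetP/idP => [[y yX ->]|xX]; first by rewrite addrC addKr.
by exists (x - u); rewrite // addrC subrK.
Qed.

Section Matrices.
Variable n : nat.
Local Notation mat := 'M['F_2]_(2, n.+2).
Local Notation jlast := (ord_max : 'I_n.+2).
Local Notation vec := 'rV['F_2]_n.+1.
Implicit Types x y z : mat.

Definition top x : vec := row 0 (col' jlast x).
Definition bottom x : vec := row 1 (col' jlast x).
Definition last_column x : cell := (x 0 jlast, x 1 jlast).
Definition coord x := (top x, bottom x, last_column x).

Definition of_coord (u : vec * vec * cell) : mat :=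
  let: (a, b, c) := u in \matrix_(i, j)
    if unlift jlast j is Some k then (if i == 0 then a else b) 0 k
    else if i == 0 then c.1 else c.2.

Lemma of_coordK : cancel of_coord coord.
Proof.
move=> [[a b] [s t]]; rewrite /coord /last_column !mxE unlift_none /=.
by congr (_, _, _); apply/rowP => j; rewrite !mxE liftK.
Qed.

Lemma coordK : cancel coord of_coord.
Proof.
move=> x; apply/matrixP => i j; rewrite mxE.
have i01 : i = 0 \/ i = 1 by apply: F2_cases.
by case: (unliftP jlast j) => [k|] ->; case: i01 => ->; rewrite ?mxE.
Qed.

Lemma coord_bij : bijective coord.
Proof. exact: Bijective coordK of_coordK. Qed.

Lemma Q_coord x z :
  Q (x - z) = dot (top x - top z) (bottom x - bottom z)
              + polar_cell (last_column x) (last_column z).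
Proof.
rewrite /Q (bigD1_ord jlast) //= addrC !mxE; congr (_ + _).
by apply: eq_bigr => j _; rewrite !mxE.
Qed.

Lemma in_W1 x : (x \in W1 n.+2) = coord_W1 (bottom x) (last_column x).
Proof.
rewrite inE; apply/eqP/andP => [/rowP x1|[/eqP/rowP b0 /eqP xl]].
  split; last by have := x1 jlast; rewrite !mxE => /eqP.
  by apply/eqP/rowP => j; have := x1 (lift jlast j); rewrite !mxE.
apply/rowP => j; rewrite !mxE; case: (unliftP jlast j) => [k|] -> //.
by have := b0 k; rewrite !mxE.
Qed.

Lemma in_translate_W1 x :
  (x \in translate (vmat n.+2) (W1 n.+2))
  = coord_vW1 (bottom x) (last_column x).
Proof.
rewrite in_translate in_W1 /coord_W1 /coord_vW1 /= !mxE !eqxx subr_eq0.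
rewrite (_ : bottom _ = bottom x) //.
apply/rowP => j; rewrite !mxE eqSS lift_max.
by rewrite (ltn_eqF (ltn_ord j)) andbF subr0.
Qed.

Lemma in_V1_V2 x :
  (x \in V1 n.+2 :|: V2 n.+2) = coord_V (bottom x) (last_column x).
Proof.
rewrite in_setU [x \in V1 _]inE [x \in V2 _]inE !forall_last.
rewrite in_W1 in_translate_W1 /coord_W1 /coord_vW1 /coord_V.
case: (bottom x == 0) => //=.
by case: (F2_cases (x 0 jlast)) (F2_cases (x 1 jlast)) => -> [] ->.
Qed.

Local Notation p := (delta_mx 0 ord_max : vec).

Lemma p_neq0 : p != 0.
Proof. by apply/rV0Pn; exists ord_max; rewrite mxE !eqxx. Qed.

Lemma in_Cset x : (x \in Cset n.+2) = coord_C p (bottom x) (last_column x).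
Proof.
rewrite inE; apply/forallP/andP => [xC|[/eqP/rowP bp /= /eqP xl] j].
  split; last by have /and3P[/implyP] := xC jlast; rewrite eqxx => /(_ isT).
  apply/eqP/rowP => k; rewrite !mxE eqxx /= -val_eqE /=.
  have /and3P[_] := xC (lift jlast k); rewrite lift_max !eqSS !ltnS.
  have: (k <= n)%N by rewrite -ltnS.
  by case: (ltngtP k n) => // _ _ /= => [_ /eqP|/eqP].
case: (unliftP jlast j) => [k|] ->; last first.
  by rewrite xl !eqxx /= (gtn_eqF (ltnSn _)) ltnNge leqnSn.
have := bp k; rewrite !mxE lift_max !eqSS !ltnS /= => ->.
rewrite (ltn_eqF (ltn_ord k)) (_ : (k == ord_max) = (k == n :> nat)) //=.
by case: ltngtP.
Qed.

Definition gamma x z : 'F_2 := gamma_form p (coord x) (coord z).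

Lemma Gamma2_form_graph : @Gamma2 n.+2 =2 form_graph gamma.
Proof.
have disj1 : [disjoint W1 n.+2 & translate (vmat n.+2) (W1 n.+2)].
  rewrite disjoint_subset; apply/subsetP => x; rewrite in_W1 inE.
  by rewrite in_translate_W1 /coord_vW1 => /andP[_ /eqP ->]; rewrite andbF.
have disj2 : [disjoint V1 n.+2 :|: V2 n.+2 & Cset n.+2].
  rewrite disjoint_subset; apply/subsetP => x; rewrite in_V1_V2 inE in_Cset.
  by rewrite /coord_C => /andP[/eqP -> _]; rewrite eq_sym (negbTE p_neq0).
have VO : @VOplus n.+2 =2 form_graph (fun x z => Q (x - z)) by [].
move=> x z.
rewrite /Gamma2 (switch_form_graph disj2 (switch_form_graph disj1 VO)).
rewrite /form_graph; congr (_ && (_ == _)).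
rewrite !in_V1_V2 !in_Cset !in_W1 !in_translate_W1 Q_coord.
by rewrite /gamma /gamma_form /= (gamma_blockE _ _ _ _ p_neq0) -!addrA.
Qed.

Lemma gamma_sym x z : gamma x z = gamma z x.
Proof. exact: gamma_form_sym. Qed.

Lemma gamma_diag x : gamma x x = 0.
Proof. exact: gamma_form_diag. Qed.

Lemma sum_chi_gamma x : \sum_z chi (gamma x z) = (2 ^ n.+2)%N%:Z.
Proof.
rewrite -(sum_chi_gamma_form p (coord x)) [RHS](reindex coord) //.
exact: onW_bij coord_bij.
Qed.

Lemma sum_chi_gamma_W1 x :
  \sum_(z in W1 n.+2) chi (gamma x z) = (2 ^ n.+2)%N%:Z *+ (x \in W1 n.+2).
Proof.
rewrite in_W1 -(sum_chi_gamma_form_W1 p (coord x)) [RHS](reindex coord).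
  by apply: eq_bigl => z; rewrite in_W1.
exact: onW_bij coord_bij.
Qed.

Lemma gamma_W1 x z : x \in W1 n.+2 -> z \in W1 n.+2 -> gamma x z = 0.
Proof. by rewrite !in_W1; apply: (@gamma_form_W1 _ p (coord x) (coord z)). Qed.

Lemma card_W1 : #|W1 n.+2| = (2 ^ n.+2)%N.
Proof.
have W0 : 0 \in W1 n.+2 by rewrite inE linear0.
suff: #|W1 n.+2|%:Z = (2 ^ n.+2)%N%:Z by case.
have := sum_chi_gamma_W1 0; rewrite W0 mulr1n => <-.
rewrite -sum1_card -natz natr_sum; apply: eq_bigr => z zW.
by rewrite gamma_W1.
Qed.

Lemma W1_regular_clique : regular_clique (@Gamma2 n.+2) (2 ^ n.+1) (W1 n.+2).
Proof.
split; [|by rewrite expn_gt0|] => x; last first.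
  move=> xW; have := card_nbrs_setI_form Gamma2_form_graph xW.
  rewrite sum_chi_gamma_W1 (negbTE xW) addr0 card_W1 expnS.
  by move: #|_ :&: _| (2 ^ n.+1)%N => a b; lia.
by move=> z xW zW xz; rewrite Gamma2_form_graph /form_graph xz gamma_W1.
Qed.

Lemma sign_dot_gammaE x y :
  sign_dot gamma x y = sign_dot (gamma_form p) (coord x) (coord y).
Proof. exact: sign_dot_bij coord_bij. Qed.

Lemma sign_dot_gamma_cases x y : x != y ->
  sign_dot gamma x y = 0 \/
  gamma x y = 1 /\ exists s, sign_dot gamma x y = (2 ^ n.+3)%N%:Z * chi s.
Proof.
rewrite sign_dot_gammaE => xy; apply: sign_dot_gamma_form_cases.
by rewrite (can_eq coordK).
Qed.

Lemma card_mat : #|{: mat}| = (2 ^ (2 * n.+2))%N.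
Proof. by rewrite card_mx card_Fp. Qed.

Lemma card_nbrs_Gamma2 x :
  #|nbrs (@Gamma2 n.+2) x| = ((2 ^ n.+1 + 1) * (2 ^ n.+2 - 1))%N.
Proof.
have := card_nbrs_form gamma_diag Gamma2_form_graph sum_chi_gamma x.
rewrite card_mat mulnC expnM !expnS expn0; have := expn_gt0 2 n.
by move: (2 ^ n)%N => a; nia.
Qed.

Local Notation mu := (2 ^ n.+1 * (2 ^ n.+1 + 1))%N.

Lemma card_common_nbrs_Gamma2 x y : x != y ->
  (#|common_nbrs (@Gamma2 n.+2) x y|%:Z + (Gamma2 x y)%:Z *+ 2) *+ 4
  = mu%:Z *+ 4 + sign_dot gamma x y.
Proof.
move=> xy; rewrite (card_common_nbrs_form gamma_sym gamma_diag Gamma2_form_graph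
  sum_chi_gamma xy).
rewrite card_mat; congr (_ + _); rewrite mulnC expnM !expnS expn0.
by move: (2 ^ n)%N => a; nia.
Qed.

Lemma Gamma2_edge_regular :
  edge_regular (@Gamma2 n.+2) (2 ^ (2 * n.+2))
    ((2 ^ n.+1 + 1) * (2 ^ n.+2 - 1)) (2 * (2 ^ n + 1) * (2 ^ n.+1 - 1)).
Proof.
split.
- exact: form_graph_simple gamma_sym Gamma2_form_graph.
- exact: card_mat.
- have /card_gt0P[y] : (0 < #|nbrs (@Gamma2 n.+2) 0%R|)%N.
    by rewrite card_nbrs_Gamma2 !expnS; have := expn_gt0 2 n; nia.
  by rewrite inE; exists 0, y.
- exact: card_nbrs_Gamma2.
move=> x y xGy; have := xGy; rewrite Gamma2_form_graph => /andP[xy /eqP gxy].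
have := card_common_nbrs_Gamma2 xy; rewrite xGy !expnS.
have [->|[]] := sign_dot_gamma_cases xy.
  by have := expn_gt0 2 n; move: (2 ^ n)%N => a; nia.
by rewrite gxy.
Qed.

Lemma Gamma2_nonadjacent_common_nbrs x y : x != y -> ~~ Gamma2 x y ->
  #|common_nbrs (@Gamma2 n.+2) x y| \in [:: mu - 2 ^ n.+1; mu; mu + 2 ^ n.+1]%N.
Proof.
move=> xy /negbTE xGy; have := card_common_nbrs_Gamma2 xy.
rewrite xGy mul0rn addr0 !inE.
have [->|[_ [s ->]]] := sign_dot_gamma_cases xy.
  by rewrite addr0; lia.
by case: (chi_cases s) => ->; rewrite !expnS; move: (2 ^ n)%N => a; nia.
Qed.

Lemma exists_Gamma2_nonadjacent u w : gamma_form p u w = 1 ->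
  exists x y, [/\ x != y, ~~ Gamma2 x y &
    #|common_nbrs (@Gamma2 n.+2) x y|%:Z *+ 4
    = mu%:Z *+ 4 + sign_dot (gamma_form p) u w].
Proof.
move=> guw; exists (of_coord u), (of_coord w).
have xy : of_coord u != of_coord w.
  apply: contra_eq_neq guw => /(can_inj of_coordK) ->.
  by rewrite gamma_form_diag.
have xGy : ~~ Gamma2 (of_coord u) (of_coord w).
  by rewrite Gamma2_form_graph /form_graph /gamma !of_coordK guw andbF.
split=> //; have := card_common_nbrs_Gamma2 xy.
by rewrite (negbTE xGy) addr0 sign_dot_gammaE !of_coordK.
Qed.

Lemma Gamma2_nonadjacent_common_nbrs_attained k :
  k \in [:: mu - 2 ^ n.+1; mu; mu + 2 ^ n.+1]%N -> exists x y,
  [/\ x != y, ~~ Gamma2 x y & #|common_nbrs (@Gamma2 n.+2) x y| = k].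
Proof.
have attained u w : gamma_form p u w = 1 ->
    sign_dot (gamma_form p) u w = (k%:Z - mu%:Z) *+ 4 ->
    exists x y,
      [/\ x != y, ~~ Gamma2 x y & #|common_nbrs (@Gamma2 n.+2) x y| = k].
  move=> /exists_Gamma2_nonadjacent[x [y [xy xGy cxy]]] dot_uw.
  by exists x, y; split=> //; lia.
rewrite !inE => /or3P[] /eqP kE.
- have [u [w [guw dot_uw]]] := exists_sign_dot_gamma_form_chi 1 p_neq0.
  apply: attained guw _; rewrite dot_uw (_ : chi 1 = -1) // kE !expnS.
  by move: (2 ^ n)%N => a; nia.
- have [u [w [guw dot_uw]]] := exists_sign_dot_gamma_form0 p_neq0.
  by apply: attained guw _; rewrite dot_uw kE subrr.
- have [u [w [guw dot_uw]]] := exists_sign_dot_gamma_form_chi 0 p_neq0.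
  apply: attained guw _; rewrite dot_uw (_ : chi 0 = 1) // kE !expnS.
  by move: (2 ^ n)%N => a; nia.
Qed.

Lemma Gamma2_strictly_Neumaier : strictly_Neumaier (@Gamma2 n.+2).
Proof.
have [|x [y [xy xGy cxy]]] := @Gamma2_nonadjacent_common_nbrs_attained mu.
  by rewrite !inE eqxx orbT.
have [|x' [y' [xy' xGy' cxy']]] :=
  @Gamma2_nonadjacent_common_nbrs_attained (mu + 2 ^ n.+1)%N.
  by rewrite !inE eqxx !orbT.
apply: (strictly_Neumaier_criterion Gamma2_edge_regular W1_regular_clique
  xy xGy xy' xGy').
by rewrite cxy cxy'; have := expn_gt0 2 n.+1; lia.
Qed.

End Matrices.

Local Close Scope ring_scope.

Theorem theorem20 (e : nat) (he : 2 <= e) :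
  let G := @Gamma2 e in
  let mu := 2 ^ (e - 1) * (2 ^ (e - 1) + 1) in
  [/\ strictly_Neumaier G,
      edge_regular G (2 ^ (2 * e))
        ((2 ^ (e - 1) + 1) * (2 ^ e - 1))
        (2 * (2 ^ (e - 2) + 1) * (2 ^ (e - 1) - 1)),
      exists S : {set 'M['F_2]_(2, e)},
        regular_clique G (2 ^ (e - 1)) S /\ #|S| = 2 ^ e
    & forall n : nat,
        (exists x y : 'M['F_2]_(2, e),
          [/\ x != y, ~~ G x y & #|common_nbrs G x y| = n])
        <-> n \in [:: mu - 2 ^ (e - 1); mu; mu + 2 ^ (e - 1)]].
Proof.
case: e he => [|[|n]] // _ G mu.
rewrite {}/G {}/mu subn1 subn2 /=; split.
- exact: Gamma2_strictly_Neumaier.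
- exact: Gamma2_edge_regular.
- by exists (W1 n.+2); split; [exact: W1_regular_clique|exact: card_W1].
move=> k; split=> [[x [y [xy xGy <-]]]|].
  exact: Gamma2_nonadjacent_common_nbrs.
exact: Gamma2_nonadjacent_common_nbrs_attained.
Qed.
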